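(* Let $P=\{x\in\mathbb R^n : Ax=b,\ Bx\le d\}$ with $A\in\mathbb R^{m_A\times n}$, $B\in\mathbb R^{m_B\times n}$ be a pointed polyhedron. Let $$P_{A,B}=\{(x,y^+,y^-)\in\mathbb R^{n+2m_B} : Ax=0,\ Bx=y^+-y^-,\ \|y^+\|_1+\|y^-\|_1=1,\ y^+,y^-\ge 0\}.$$ Let $S:=\{(g,y^+,y^-) : g\in\mathcal C(A,B),\ y^+_i=\max\{(Bg)_i,0\},\ y^-_i=\max\{-(Bg)_i,0\}\ (i\le m_B)\}$ and $T:=\{(0,y^+,y^-) : \text{for some } i\le m_B,\ y^+_i=y^-_i=1,\ y^+_j=y^-_j=0\ (j\ne i)\}$. Then there is a subset $T'\subseteq T$ with $|T'|\le m_B$ such that $T'\cup S$ is the set of extreme-ray generators of the cone $\{(x,y^+,y^-) : Ax=0,\ Bx=y^+-y^-,\ y^\pm\ge 0\}$, and the vertex set of the polytope $P_{A,B}$ is $S_1\cup T'_1$, where $S_1$ and $T'_1$ consist of the vectors $r/(\|y^+\|_1+\|y^-\|_1)$ for $r=(x,y^+,y^-)$ in $S$ and in $T'$ respectively.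
   Context: $P$ is pointed means $\operatorname{rank}\binom{A}{B}=n$. The set of circuits $\mathcal C(A,B)$ of $P$ consists of all $g\in\ker(A)\setminus\{0\}$ normalized to coprime integer components for which $Bg$ is support-minimal over $\{Bx : x\in\ker(A)\setminus\{0\}\}$, i.e. no $x\in\ker(A)\setminus\{0\}$ satisfies $\operatorname{supp}(Bx)\subsetneq\operatorname{supp}(Bg)$.
   Formalization: A and B are taken to be rational matrices (viewed as real ones), since for general real A, B circuits with coprime integer components need not exist and the claim fails, e.g. A = (1, −√2), B = I. *)

(* Defs.v *)
From HB Require Import structures.
From mathcomp Require Import all_boot all_order all_algebra.
From mathcomp Require Import reals.
Set Implicit Arguments. Unset Strict Implicit. Unset Printing Implicit Defensive.
Import Order.TTheory GRing.Theory Num.Theory.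
Local Open Scope ring_scope.

Section PolyDefs.
Variables (R : realType) (n mB : nat).

(* A point (x, y^+, y^-) of R^(n + 2 mB). *)
Definition trip := ('cV[R]_n * 'cV[R]_mB * 'cV[R]_mB)%type.

Definition tzero : trip := (0, 0, 0).
Definition tadd (u v : trip) : trip :=
  (u.1.1 + v.1.1, u.1.2 + v.1.2, u.2 + v.2).
Definition tscale (c : R) (u : trip) : trip := (c *: u.1.1, c *: u.1.2, c *: u.2).

Definition l1 m (y : 'cV[R]_m) : R := \sum_i `|y i 0|.
Definition nonnegv m (y : 'cV[R]_m) : Prop := forall i, 0 <= y i 0.

Definition ynorm (r : trip) : R := l1 r.1.2 + l1 r.2.

Definition ABcone mA (A : 'M[R]_(mA, n)) (B : 'M[R]_(mB, n)) (r : trip) : Prop :=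
  A *m r.1.1 = 0 /\ B *m r.1.1 = r.1.2 - r.2 /\ nonnegv r.1.2 /\ nonnegv r.2.

Definition PAB mA (A : 'M[R]_(mA, n)) (B : 'M[R]_(mB, n)) (r : trip) : Prop :=
  ABcone A B r /\ ynorm r = 1.

Definition extreme_ray (K : trip -> Prop) (r : trip) : Prop :=
  K r /\ r <> tzero /\
  forall u v, K u -> K v -> tadd u v = r -> exists2 c, 0 <= c & u = tscale c r.

Definition extreme_point (Q : trip -> Prop) (p : trip) : Prop :=
  Q p /\ forall u v (t : R), Q u -> Q v -> 0 < t < 1 ->
    p = tadd (tscale t u) (tscale (1 - t) v) -> u = v.

Definition suppv m (y : 'cV[R]_m) : {set 'I_m} := [set i | y i 0 != 0].

Definition circuit mA (A : 'M[R]_(mA, n)) (B : 'M[R]_(mB, n)) (g : 'cV[R]_n) : Prop :=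
  A *m g = 0 /\ g <> 0 /\
  (exists z : 'I_n -> int,
      (forall i, g i 0 = (z i)%:~R) /\
      (forall d : int, (forall i, (d %| z i)%Z) -> `|d| = 1)) /\
  ~ (exists x : 'cV[R]_n, A *m x = 0 /\ x <> 0 /\ suppv (B *m x) \proper suppv (B *m g)).

Definition S_elt (B : 'M[R]_(mB, n)) (g : 'cV[R]_n) : trip :=
  (g, \col_i Num.max ((B *m g) i 0) 0, \col_i Num.max (- (B *m g) i 0) 0).

Definition inS mA (A : 'M[R]_(mA, n)) (B : 'M[R]_(mB, n)) (r : trip) : Prop :=
  exists2 g, circuit A B g & r = S_elt B g.

Definition T_elt (i : 'I_mB) : trip := (0, delta_mx i 0, delta_mx i 0).

End PolyDefs.

(* Main.v *)
Require Import Defs.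
From HB Require Import structures.
From mathcomp Require Import all_boot all_order all_algebra.
From mathcomp Require Import boolp reals.
From mathcomp Require Import lra.
Set Implicit Arguments. Unset Strict Implicit. Unset Printing Implicit Defensive.
Import Order.TTheory GRing.Theory Num.Theory.
Local Open Scope ring_scope.

(** A cone element (x, p, q) with p_i, q_i > 0 for some i contains a positive
    multiple of T_i as a summand, so it is extreme only if it is a multiple of
    T_i; and T_i is extreme unless Bx = e_i for some x in ker A, in which case
    T_i = (x, e_i, 0) + (-x, 0, e_i).  This determines T'.  All other cone
    elements are (x, (Bx)^+, (Bx)^-), and x |-> (x, (Bx)^+, (Bx)^-) is additive
    on vectors whose images under B agree in sign; hence such an element is
    extreme iff supp(Bx) is minimal.  By pointedness, minimality makes
    {y in ker A : supp(By) <= supp(Bx)} a line; being the kernel of a rational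
    matrix it contains a primitive integer vector, which is the circuit.
    The l1 norm of (p, q) is additive on the cone and positive off 0, so P_{A,B}
    is a base of the cone and its vertices are the normalized extreme rays. *)

(** * Primitive integer vectors and rational lines *)

Section PrimitiveVectors.

(** Coprimality via common divisors; the case [d = 0] makes such a vector nonzero. *)
Definition primitive_vec n (z : 'I_n -> int) : Prop :=
  forall d : int, (forall i, (d %| z i)%Z) -> `|d| = 1.

(** The factor is a quotient of two integer entries, hence rational. In lowest terms its numerator
    divides every [z i] and its denominator every [z' i], so both are units. *)
Lemma primitive_vec_scale_eq1 (R : realType) n (z z' : 'I_n -> int) (c : R) :
  primitive_vec z -> primitive_vec z' -> 0 < c ->
  (forall i, (z i)%:~R = c * (z' i)%:~R) -> c = 1.
Proof.
move=> pz pz' c0 zz'.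
have [i zi0] : exists i, z' i != 0.
  apply: contrapT => z'0; suff: `|0 : int| = 1 by [].
  by apply: pz' => i; rewrite dvd0z; apply/negPn/negP => zi; apply: z'0; exists i.
pose q : rat := (z i)%:~R / (z' i)%:~R.
have cq : c = ratr q.
  by rewrite /q fmorph_div !rmorph_int zz' mulfK // intr_eq0.
have num_den j : denq q * z j = numq q * z' j.
  apply: (@intr_inj R); rewrite !rmorphM /= zz' cq.
  rewrite -{2}(divq_num_den q) fmorph_div !rmorph_int.
  by rewrite mulrA [X in X * _]mulrC divfK ?intr_eq0 ?denq_neq0.
have num1 : `|numq q| = 1.
  apply: pz => j; rewrite -(Gauss_dvdzr (n := denq q)) ?num_den ?dvdz_mulr//.
  exact: coprime_num_den.
have den1 : `|denq q| = 1.
  apply: pz' => j; rewrite -(Gauss_dvdzr (n := numq q)) -?num_den ?dvdz_mulr//.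
  by rewrite coprimez_sym; exact: coprime_num_den.
have q0 : 0 < q by rewrite -(ltr0q R) -cq.
rewrite cq -(divq_num_den q) -(gtr0_norm (denq_gt0 q)) den1.
have -> : numq q = 1 by rewrite -num1 gtr0_norm // numq_gt0.
by rewrite divr1 rmorph1.
Qed.

Lemma rat_vec_primitive n (w : 'cV[rat]_n) : w != 0 ->
  exists z : 'I_n -> int, exists q : rat,
    [/\ primitive_vec z, q != 0 & forall i, w i 0 = q * (z i)%:~R].
Proof.
(* Entries become polynomial coefficients, so that [rat_poly_scale] clears denominators and
   [zprimitive] divides out the gcd. *)
move=> w0; pose p : {poly rat} := \poly_(i < n) \sum_(j < n | j == i :> nat) w j 0.
have pE (i : 'I_n) : p`_i = w i 0.
  by rewrite coef_poly ltn_ord (eq_bigl (pred1 i)) ?big_pred1_eq.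
have [r [a a0 pr]] := rat_poly_scale p.
have r0 : r != 0.
  apply: contraNneq w0 => r0; apply/eqP/matrixP => i j.
  by rewrite ord1 mxE -pE pr r0 map_poly0 scaler0 coef0.
have sz_r : (size r <= n)%N.
  have -> : size r = size p.
    rewrite pr size_scale ?invr_eq0 ?intr_eq0// size_map_inj_poly//.
    exact: intr_inj.
  exact: size_poly.
exists (fun i => (zprimitive r)`_i), (a%:~R^-1 * (zcontents r)%:~R); split.
- move=> d dz; have : (d %| zcontents (zprimitive r))%Z.
    rewrite dvdz_contents; apply/(all_nthP 0) => i.
    rewrite size_zprimitive => ir.
    exact: (dz (Ordinal (leq_trans ir sz_r))).
  by rewrite zcontents_primitive r0 dvdz1 => /eqP dE; rewrite -abszE dE.
- by rewrite mulf_neq0 ?invr_eq0 ?intr_eq0 ?zcontents_eq0.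
- move=> i; rewrite -pE pr coefZ coef_map /= {1}(zpolyEprim r) coefZ.
  by rewrite rmorphM /= mulrA.
Qed.

End PrimitiveVectors.

(** * Extreme rays of the cone and extreme points of its slice *)

Section Trip.
Variables (R : realType) (n mB : nat).
Implicit Types u v r : trip R n mB.


Lemma taddE u v : tadd u v = u + v. Proof. by []. Qed.

Lemma tscaleE c u : tscale c u = c *: u. Proof. by case: u => -[]. Qed.

Lemma tzeroE : tzero R n mB = 0. Proof. by []. Qed.

Variables (mA : nat) (A : 'M[R]_(mA, n)) (B : 'M[R]_(mB, n)).
Local Notation K := (ABcone A B).
Implicit Types x g : 'cV[R]_n.

(** The last clause of [circuit] on its own: unlike integrality, it is invariant under nonzero real
    scaling. *)
Definition supp_minimal (g : 'cV[R]_n) : Prop :=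
  ~ exists x, A *m x = 0 /\ x <> 0 /\ suppv (B *m x) \proper suppv (B *m g).

Lemma ABcone_scale c u : 0 <= c -> K u -> K (c *: u).
Proof.
move=> c0 [Au [Bu [u1 u2]]]; split; [|split; [|split]] => /=.
- by rewrite -scalemxAr Au scaler0.
- by rewrite -scalemxAr Bu scalerBr.
- by move=> i; rewrite mxE mulr_ge0.
- by move=> i; rewrite mxE mulr_ge0.
Qed.

Lemma ABcone_S_elt x : A *m x = 0 -> K (S_elt B x).
Proof.
move=> Ax; split; [exact: Ax|split; [|split]] => /=.
- move: (B *m x) => y; apply/matrixP => i j; rewrite ord1 !mxE.
  by case: (lerP (y i 0) 0); case: (lerP (- y i 0) 0); lra.
- by move=> i; rewrite mxE le_max lexx orbT.
- by move=> i; rewrite mxE le_max lexx orbT.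
Qed.

Lemma ABcone_T_elt i : K (T_elt R n i).
Proof.
split; [exact: mulmx0|split; [by rewrite mulmx0 subrr|]].
by split=> j /=; rewrite mxE eqxx andbT; case: eqP.
Qed.

Lemma S_eltZ c x : 0 <= c -> S_elt B (c *: x) = c *: S_elt B x.
Proof.
move=> c0; rewrite /S_elt -scalemxAr; move: (B *m x) => y.
congr (_, _, _); apply/matrixP => i j; rewrite !mxE maxr_pMr// mulr0//.
by rewrite mulrN.
Qed.

Lemma S_eltD x y : (forall i, 0 <= (B *m x) i 0 * (B *m y) i 0) ->
  S_elt B (x + y) = S_elt B x + S_elt B y.
Proof.
rewrite /S_elt mulmxDr; move: (B *m x) (B *m y) => a b ab.
congr (_, _, _); apply/matrixP => i j; rewrite ord1 !mxE; move: (ab i).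
  case: (lerP (a i 0) 0); case: (lerP (b i 0) 0); case: (lerP (a i 0 + b i 0) 0);
    by nra.
case: (lerP (- a i 0) 0); case: (lerP (- b i 0) 0); case: (lerP (- (a i 0 + b i 0)) 0);
  by nra.
Qed.

(** Two nonnegative numbers, one of them zero, are the positive and negative parts of their
    difference. *)
Lemma S_elt_unique r : K r -> (forall i, r.1.2 i 0 = 0 \/ r.2 i 0 = 0) ->
  r = S_elt B r.1.1.
Proof.
case: r => -[x p] q [/= _ [Bx [p0 q0]]] /= pq.
congr (_, _, _); apply/matrixP => i j; rewrite ord1 Bx !mxE.
  by case: lerP; move: (p0 i) (q0 i); case: (pq i) => ->; lra.
by case: lerP; move: (p0 i) (q0 i); case: (pq i) => ->; lra.
Qed.

Lemma extreme_ray_scale c r : 0 < c -> extreme_ray K r -> extreme_ray K (c *: r).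
Proof.
move=> c0 [Kr [r0 ext]]; have cn0 := lt0r_neq0 c0; split; [|split].
- exact/ABcone_scale/Kr/ltW.
- by move=> /eqP; rewrite tzeroE scaler_eq0 (negPf cn0) => /eqP.
- move=> u v Ku Kv; rewrite taddE => uv.
  have ci : 0 <= c^-1 by rewrite invr_ge0 ltW.
  have [|||t t0 ut] := ext (c^-1 *: u) (c^-1 *: v).
  + exact: ABcone_scale.
  + exact: ABcone_scale.
  + by rewrite taddE -scalerDr uv scalerK.
  + exists t => //; move: ut; rewrite !tscaleE => ut.
    by rewrite scalerA mulrC -scalerA -ut scalerKV.
Qed.

Lemma ynormE u : K u -> ynorm u = \sum_i u.1.2 i 0 + \sum_i u.2 i 0.
Proof.
move=> [_ [_ [u1 u2]]]; rewrite /ynorm /l1.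
by congr (_ + _); apply: eq_bigr => i _; rewrite ger0_norm.
Qed.

Lemma ynormD u v : K u -> K v -> K (u + v) -> ynorm (u + v) = ynorm u + ynorm v.
Proof.
move=> Ku Kv Kuv; rewrite !ynormE// -!big_split /=.
by apply: eq_bigr => i _; rewrite !mxE addrACA.
Qed.

Lemma ynormZ c u : 0 <= c -> ynorm (c *: u) = c * ynorm u.
Proof.
move=> c0; rewrite /ynorm /l1 mulrDr !mulr_sumr.
by congr (_ + _); apply: eq_bigr => i _; rewrite mxE normrM (ger0_norm c0).
Qed.

Lemma ynorm_ge0 u : 0 <= ynorm u.
Proof. by rewrite /ynorm /l1 addr_ge0 ?sumr_ge0. Qed.

Lemma suppvZ m (y : 'cV[R]_m) c : c != 0 -> suppv (c *: y) = suppv y.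
Proof.
by move=> c0; apply/setP => i; rewrite !inE mxE mulf_eq0 (negPf c0).
Qed.

Hypothesis pointed : forall x, A *m x = 0 -> B *m x = 0 -> x = 0.

Lemma ynorm_eq0 u : K u -> ynorm u = 0 -> u = 0.
Proof.
case: u => -[x p] q [/= Ax [Bx _]].
have l1_0 m (y : 'cV[R]_m) : l1 y = 0 -> y = 0.
  move=> /eqP; rewrite psumr_eq0// => /allP y0.
  apply/matrixP => i j; rewrite ord1 mxE; apply/eqP.
  by rewrite -normr_eq0; apply: (y0 i); rewrite mem_index_enum.
move=> /eqP; rewrite paddr_eq0 ?sumr_ge0// => /andP[/eqP/l1_0/= p0 /eqP/l1_0/= q0].
by rewrite (pointed Ax) ?Bx p0 q0 ?subr0.
Qed.

Lemma ynorm_gt0 u : K u -> u <> 0 -> 0 < ynorm u.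
Proof.
by move=> Ku u0; rewrite lt0r ynorm_ge0 andbT; apply/eqP => /ynorm_eq0; auto.
Qed.

(** A sum [u + v = p] of nonzero cone elements is a convex combination of their normalizations, with
    weights [ynorm u] and [ynorm v]. Conversely, the terms of a convex combination equal to [p] are
    multiples of [p], and norm 1 fixes the factors. *)
Lemma extreme_pointP p :
  extreme_point (PAB A B) p <-> extreme_ray K p /\ ynorm p = 1.
Proof.
split=> [[[Kp p1] ext]|[[Kp [p0 ext]] p1]]; split => //.
- split=> //; split=> [pE|u v Ku Kv].
    move: p1; rewrite pE tzeroE -(scale0r 0) ynormZ// mul0r => /eqP.
    by rewrite eq_sym oner_eq0.
  rewrite taddE => uv; have := ynormD Ku Kv; rewrite uv p1 => /(_ Kp) uv1.
  have [/(ynorm_eq0 Ku)->|u0] := eqVneq (ynorm u) 0.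
    by exists 0; rewrite // tscaleE scale0r.
  have [/(ynorm_eq0 Kv) v0|v0] := eqVneq (ynorm v) 0.
    by exists 1; rewrite // tscaleE scale1r -uv v0 addr0.
  have tu : 0 < ynorm u by rewrite lt0r u0 ynorm_ge0.
  have tv : 0 < ynorm v by rewrite lt0r v0 ynorm_ge0.
  have norm1 w : K w -> 0 < ynorm w -> PAB A B ((ynorm w)^-1 *: w).
    move=> Kw w0; have w0' : 0 <= (ynorm w)^-1 by rewrite invr_ge0 ltW.
    by split; [exact: ABcone_scale|rewrite ynormZ// mulVf ?gt_eqF].
  have v1 : 1 - ynorm u = ynorm v by rewrite uv1 addrC addKr.
  have uE : (ynorm u)^-1 *: u = (ynorm v)^-1 *: v.
    apply: (ext _ _ (ynorm u)); [exact: norm1|exact: norm1| |].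
      by rewrite tu /= -subr_gt0 v1.
    by rewrite !tscaleE taddE v1 !scalerKV// uv.
  exists (ynorm u); first exact: ltW.
  have pE : p = (ynorm u)^-1 *: u.
    by rewrite -uv -{1}(scalerKV u0 u) -(scalerKV v0 v) -uE -scalerDl -uv1 scale1r.
  by rewrite tscaleE pE scalerKV.
- move=> u v t [Ku u1] [Kv v1] /andP[t0 t1].
  rewrite !tscaleE taddE => pE.
  have t1' : 0 < 1 - t by rewrite subr_gt0.
  have eqp w w' s : 0 < s -> K w -> K w' -> ynorm w = 1 -> p = s *: w + w' -> w = p.
    move=> s0 Kw Kw' w1 pw.
    have [||c c0] := ext (s *: w) w' _ _ (esym pw) => //.
      by apply: ABcone_scale; rewrite // ltW.
    rewrite tscaleE => swE; have := congr1 (@ynorm _ _ _) swE.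
    rewrite !ynormZ ?(ltW s0)// w1 p1 !mulr1 => sc; move: swE; rewrite -sc.
    by apply: scalerI; rewrite gt_eqF.
  rewrite (eqp u ((1 - t) *: v) t)//; last by apply: ABcone_scale; rewrite // ltW.
  rewrite (eqp v (t *: u) (1 - t))//; last by rewrite addrC.
  by apply: ABcone_scale; rewrite // ltW.
Qed.

Lemma supp_minimal_line g x : g <> 0 -> A *m g = 0 -> supp_minimal g ->
  A *m x = 0 -> suppv (B *m x) \subset suppv (B *m g) -> exists c, x = c *: g.
Proof.
move=> g0 Ag gmin Ax sub.
have [i gi] : exists i, (B *m g) i 0 != 0.
  apply: contrapT => Bg0; apply/g0/pointed => //; apply/matrixP => i j.
  by rewrite ord1 [RHS]mxE; apply/eqP/negPn/negP => gi; apply: Bg0; exists i.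
(* This [c] cancels entry [i], so the support of [B *m (x - c *: g)] is strictly inside that of
   [B *m g], and minimality forces [x - c *: g = 0]. *)
pose c := (B *m x) i 0 / (B *m g) i 0.
exists c; apply/subr0_eq; apply: contrapT => z0; apply: gmin.
exists (x - c *: g).
have Bz j : (B *m (x - c *: g)) j 0 = (B *m x) j 0 - c * (B *m g) j 0.
  by rewrite mulmxBr -scalemxAr; move: (B *m x) (B *m g) => y y'; rewrite !mxE.
split; [|split=> //].
  by rewrite mulmxBr -scalemxAr Ax Ag scaler0 subr0.
apply/properP; split; last first.
  by exists i; rewrite !inE// Bz /c divfK// subrr eqxx.
apply/fintype.subsetP => j; rewrite !inE Bz; apply: contraNneq => gj.
have := fintype.subsetP sub j; rewrite !inE gj eqxx mulr0 subr0.
by case: eqP => // _ /(_ isT).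
Qed.

(** By nonnegativity a summand [u] inherits the zeros in the [y] parts of [S_elt B g]. Its [x] part
    thus falls under [supp_minimal_line], and [u] is [S_elt] of a multiple of [g]. *)
Lemma S_elt_extreme g : A *m g = 0 -> g <> 0 -> supp_minimal g ->
  extreme_ray K (S_elt B g).
Proof.
move=> Ag g0 gmin; split; first exact: ABcone_S_elt.
split=> [[]//|u v Ku Kv]; rewrite taddE => uv.
have [Au [Bu [u1 u2]]] := Ku; have [_ [_ [v1 v2]]] := Kv.
have p0 i : (B *m g) i 0 <= 0 -> u.1.2 i 0 = 0.
  move=> gi; have [_ /(congr1 (fun y : 'cV__ => y i 0)) + _] := uv.
  by rewrite [RHS]mxE max_r// mxE; move: (u1 i) (v1 i); lra.
have q0 i : 0 <= (B *m g) i 0 -> u.2 i 0 = 0.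
  move=> gi; have [_ _ /(congr1 (fun y : 'cV__ => y i 0))] := uv.
  by rewrite [RHS]mxE max_r ?oppr_le0// mxE; move: (u2 i) (v2 i); lra.
have [c uc] : exists c, u.1.1 = c *: g.
  apply: supp_minimal_line => //; apply/fintype.subsetP => i; rewrite !inE.
  by apply: contraNneq => gi; rewrite Bu !mxE p0 ?q0 ?gi// subrr.
have uS : u = S_elt B u.1.1.
  apply: S_elt_unique => // i.
  by case: (lerP ((B *m g) i 0) 0) => gi; [left; exact: p0|right; apply/q0/ltW].
have [c0|c0] := lerP 0 c.
  by exists c => //; rewrite uS tscaleE uc S_eltZ.
(* For [c < 0] the signs in [u] oppose those of [c *: (B *m g)] unless [B *m g = 0]. *)
case: g0; apply: pointed => //; apply/matrixP => i j; rewrite ord1 [RHS]mxE.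
have Bui : u.1.2 i 0 - u.2 i 0 = c * (B *m g) i 0.
  by transitivity ((B *m u.1.1) i 0); [rewrite Bu !mxE|rewrite uc -scalemxAr mxE].
move: (u1 i) (u2 i) Bui.
by have [y0|y0] := lerP ((B *m g) i 0) 0; [rewrite (p0 _ y0)|rewrite (q0 _ (ltW y0))];
  move: y0; set y := (B *m g) i 0; nra.
Qed.

(** Both [y] parts of a summand are multiples of [delta_mx i 0]. Unequal coefficients would give,
    after rescaling, an excluded [x]; equal ones put the [x] part in both kernels, so it is 0. *)
Lemma T_elt_extreme i : (~ exists x, A *m x = 0 /\ B *m x = delta_mx i 0) ->
  extreme_ray K (T_elt R n i).
Proof.
move=> noti; split; first exact: ABcone_T_elt.
split=> [[/matrixP/(_ i 0)]|u v Ku Kv].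
  by rewrite !mxE !eqxx => /eqP; rewrite oner_eq0.
rewrite taddE => uv; have [Au [Bu [u1 u2]]] := Ku; have [_ [_ [v1 v2]]] := Kv.
have pE : u.1.2 = u.1.2 i 0 *: delta_mx i 0.
  apply/matrixP => j k; rewrite ord1 !mxE eqxx andbT.
  have [->|ji] := eqVneq j i; first by rewrite mulr1.
  have := congr1 (fun r : trip R n mB => r.1.2 j 0) uv.
  rewrite !mxE (negPf ji) mulr0; move: (u1 j) (v1 j); rewrite /=; lra.
have qE : u.2 = u.2 i 0 *: delta_mx i 0.
  apply/matrixP => j k; rewrite ord1 !mxE eqxx andbT.
  have [->|ji] := eqVneq j i; first by rewrite mulr1.
  have := congr1 (fun r : trip R n mB => r.2 j 0) uv.
  rewrite !mxE (negPf ji) mulr0; move: (u2 j) (v2 j); rewrite /=; lra.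
have [pq|pq] := eqVneq (u.1.2 i 0) (u.2 i 0); last first.
  case: noti; exists ((u.1.2 i 0 - u.2 i 0)^-1 *: u.1.1).
  rewrite -!scalemxAr Au scaler0 Bu {2}pE {2}qE -scalerBl scalerK//.
  by rewrite subr_eq0.
exists (u.1.2 i 0) => //; rewrite tscaleE.
have x0 : u.1.1 = 0 by apply: pointed => //; rewrite Bu pE qE pq subrr.
move: pE qE; rewrite -pq; case: u x0 {uv Ku Au Bu u1 u2 pq} => -[x p] q /= -> pE qE.
by congr (_, _, _); rewrite ?scaler0.
Qed.

(** The second alternative stays over the reals; scaling to an integer circuit is a separate
    matter. *)
Lemma extreme_ray_S_or_T r : extreme_ray K r ->
  (exists i, (~ exists x, A *m x = 0 /\ B *m x = delta_mx i 0) /\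
     exists2 c, 0 < c & r = c *: T_elt R n i) \/
  [/\ A *m r.1.1 = 0, r.1.1 <> 0, supp_minimal r.1.1 & r = S_elt B r.1.1].
Proof.
move=> ext_r; have [Kr [r0 ext]] := ext_r.
have [Ar [Br [r1 r2]]] := Kr.
case: (EM (exists i, 0 < r.1.2 i 0 /\ 0 < r.2 i 0)) => [[i [pi qi]]|npq].
  (* The largest multiple of [T_elt R n i] that can be subtracted from [r] within the cone. *)
  left; exists i; pose e := Num.min (r.1.2 i 0) (r.2 i 0).
  have e0 : 0 < e by rewrite lt_min pi qi.
  have T0 : T_elt R n i != 0.
    apply/eqP => -[/matrixP/(_ i 0)/eqP].
    by rewrite !mxE !eqxx oner_eq0.
  have [|||c c0] := ext (e *: T_elt R n i) (r - e *: T_elt R n i).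
  + by apply: ABcone_scale; [exact: ltW|exact: ABcone_T_elt].
  + split; [|split; [|split]] => /=.
    * by rewrite scaler0 subr0.
    * by rewrite scaler0 subr0 Br opprB subrKA.
    * move=> j; rewrite !mxE eqxx andbT subr_ge0.
      by have [->|_] := eqVneq j i; rewrite ?mulr1 ?mulr0 ?r1// ge_min lexx.
    * move=> j; rewrite !mxE eqxx andbT subr_ge0.
      by have [->|_] := eqVneq j i; rewrite ?mulr1 ?mulr0 ?r2// ge_min lexx orbT.
  + by rewrite taddE addrC subrK.
  rewrite tscaleE => eT.
  have cn0 : c != 0.
    apply/eqP => cE; move/eqP: eT.
    by rewrite cE scale0r scaler_eq0 (negPf T0) gt_eqF.
  have cp : 0 < c by rewrite lt0r cn0.
  have ext_T : extreme_ray K (T_elt R n i).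
    rewrite -(scalerK (lt0r_neq0 e0) (T_elt R n i)) eT scalerA.
    by apply: extreme_ray_scale; rewrite // mulr_gt0 ?invr_gt0.
  split; last first.
    by exists (c^-1 * e); rewrite ?mulr_gt0 ?invr_gt0// -scalerA eT scalerK.
  move=> [x [Ax Bx]]; have [_ [_ extT]] := ext_T.
  have delta_ge0 : nonnegv (delta_mx i 0 : 'cV[R]_mB) by case: (ABcone_T_elt i) => _ [_ []].
  have zero_ge0 : nonnegv (0 : 'cV[R]_mB) by move=> j; rewrite mxE.
  have [|||k _ [_ kp kq]] := extT (x, delta_mx i 0, 0) (- x, 0, delta_mx i 0).
  + by split; [exact: Ax|split; [rewrite /= Bx subr0|]].
  + by split; rewrite /= ?mulmxN ?Ax ?oppr0//; split; rewrite ?Bx ?sub0r.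
  + by rewrite /tadd /= addrN addr0 add0r.
  (* The [y^+] part demands [k = 1], the [y^-] part [k = 0]. *)
  move/matrixP/(_ i 0): kp; move/matrixP/(_ i 0): kq.
  by rewrite !mxE !eqxx !mulr1 => <- /eqP; rewrite oner_eq0.
right; have rE : r = S_elt B r.1.1.
  apply: S_elt_unique => // i.
  move: (r1 i) (r2 i); rewrite !le0r => /orP[/eqP|pi]; first by left.
  by move=> /orP[/eqP|qi]; [right|case: npq; exists i].
move: Ar rE; set x := r.1.1 => Ax rE.
split=> // [x0|].
  by case: r0; rewrite rE x0 -(scale0r (0 : 'cV_n)) S_eltZ// scale0r.
move=> [z [Az [z0 zx]]].
(* M dominates all ratios |(Bz)_j| / |(Bx)_j|, so B(Mx + z) and B(Mx - z) have
   the same signs and (2M)r splits as the sum of their S_elt's. *)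
pose M := 1 + \sum_j `|(B *m z) j 0| / `|(B *m x) j 0|.
have M0 : 0 < M by rewrite ltr_pwDl// sumr_ge0// => j _; rewrite divr_ge0.
have zM j : `|(B *m z) j 0| <= M * `|(B *m x) j 0|.
  have [xj|xj] := eqVneq ((B *m x) j 0) 0.
    have /properP[/fintype.subsetP/(_ j) + _] := zx.
    by rewrite !inE xj eqxx normr0 mulr0 normr_le0; case: eqP => // _ /(_ isT).
  rewrite -ler_pdivrMr ?normr_gt0// /M (bigD1 j)//= addrCA ler_wpDr//.
  by rewrite addr_ge0// sumr_ge0// => k _; rewrite divr_ge0.
have M20 : 0 < M + M by rewrite addr_gt0.
have [_ [_ ext2]] := extreme_ray_scale M20 ext_r.
have [|||c _] := ext2 (S_elt B (M *: x + z)) (S_elt B (M *: x - z)).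
- by apply: ABcone_S_elt; rewrite mulmxDr -scalemxAr Ax Az scaler0 addr0.
- by apply: ABcone_S_elt; rewrite mulmxBr -scalemxAr Ax Az scaler0 subr0.
- rewrite taddE -S_eltD.
    by rewrite addrACA subrr addr0 -scalerDl S_eltZ ?ltW// -rE.
  move=> i; have := zM i; rewrite mulmxBr mulmxDr -!scalemxAr.
  move: (B *m x) (B *m z) => a b; rewrite !mxE => ab.
  rewrite mulrC -subr_sqr subr_ge0 -real_normK ?num_real//.
  rewrite -[leRHS]real_normK ?num_real// ler_sqr ?nnegrE//.
  by rewrite normrM (gtr0_norm M0).
rewrite tscaleE rE => -[] /= zc _ _.
(* Extremality made [M *: x + z] a multiple of [x], so [z] is one too. Being nonzero, it has the
   same support under [B] as [x], which contradicts strict inclusion. *)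
have {zc}[k zk] : exists k, z = k *: x.
  exists (c * (M + M) - M); apply: (addrI (M *: x)).
  by rewrite zc scalerA -scalerDl [in RHS]addrC subrK.
have k0 : k != 0 by apply/eqP => k0; apply: z0; rewrite zk k0 scale0r.
by move: zx; rewrite zk -scalemxAr suppvZ// properxx.
Qed.

End Trip.

(** * From support-minimal real vectors to integer circuits *)

Section RationalKernel.
Variable R : realType.

(** Kernels commute with field extension, so a nonzero real solution forces a nonzero rational one.
    Transposes appear because [kermx] is a left kernel. *)
Lemma kernel_rat_neq0 m n (M0 : 'M[rat]_(m, n)) (x : 'cV[R]_n) :
  x != 0 -> map_mx ratr M0 *m x = 0 -> exists2 w : 'cV[rat]_n, w != 0 & M0 *m w = 0.
Proof.
move=> x0 Mx; have /rowV0Pn[v vM v0] : kermx M0^T != 0.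
  rewrite -(map_mx_eq0 (@ratr R)) map_kermx -map_trmx.
  apply/rowV0Pn; exists x^T; last by rewrite trmx_eq0.
  by apply/sub_kermxP; rewrite -trmx_mul Mx trmx0.
exists v^T; first by rewrite trmx_eq0.
by apply: trmx_inj; rewrite trmx_mul trmxK trmx0; apply/sub_kermxP.
Qed.

Lemma supp_minimal_circuit n mA mB (A0 : 'M[rat]_(mA, n)) (B0 : 'M[rat]_(mB, n))
    (x : 'cV[R]_n) (A := map_mx (@ratr R) A0) (B := map_mx (@ratr R) B0) :
  (forall y : 'cV[R]_n, A *m y = 0 -> B *m y = 0 -> y = 0) ->
  A *m x = 0 -> x <> 0 -> supp_minimal A B x ->
  exists2 k : R, 0 < k & circuit A B (k *: x).
Proof.
move=> pointed Ax x0 xmin.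
(* N F C is C with the rows in supp(Bx) replaced by 0. *)
pose N (F : fieldType) (C : 'M[F]_(mB, n)) : 'M[F]_(mB, n) :=
  \matrix_(i, j) if i \in suppv (B *m x) then 0 else C i j.
have NE (F : fieldType) (C : 'M[F]_(mB, n)) (y : 'cV[F]_n) i :
    (N F C *m y) i 0 = if i \in suppv (B *m x) then 0 else (C *m y) i 0.
  rewrite !mxE; case: ifP => i_x.
    by rewrite big1// => j _; rewrite mxE i_x mul0r.
  by apply: eq_bigr => j _; rewrite mxE i_x.
have mapN : map_mx ratr (N _ B0) = N _ B.
  by apply/matrixP => i j; rewrite !mxE; case: ifP; rewrite // rmorph0.
(* The stacked matrix cuts out the [y] in the kernel of [A] with the support of [B *m y] inside that
   of [B *m x]; [x] itself is a nonzero real solution. *)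
have [||w w0] := @kernel_rat_neq0 _ _ (col_mx A0 (N _ B0)) x; first exact/eqP.
  rewrite map_col_mx mapN mul_col_mx Ax; apply/eqP.
  rewrite col_mx_eq0 eqxx /=; apply/eqP/matrixP => i j; rewrite ord1 NE [RHS]mxE.
  by case: ifP; rewrite // inE => /negbFE/eqP.
rewrite mul_col_mx => /eqP; rewrite col_mx_eq0 => /andP[/eqP Aw /eqP Nw].
have [z [q [zprim q0 wz]]] := rat_vec_primitive w0.
pose wR : 'cV[R]_n := map_mx ratr w.
have AwR : A *m wR = 0 by rewrite -map_mxM Aw map_mx0.
have supp_w : suppv (B *m wR) \subset suppv (B *m x).
  apply/fintype.subsetP => i; apply: contraLR => ix.
  have := congr1 (fun y : 'cV__ => y i 0) Nw.
  rewrite NE (negPf ix) inE -map_mxM; move: (B0 *m w) => y; rewrite !mxE => ->.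
  by rewrite rmorph0 eqxx.
have [c wc] := supp_minimal_line pointed x0 Ax xmin AwR supp_w.
have c0 : c != 0.
  by apply: contraNneq w0 => c0; rewrite -(map_mx_eq0 (@ratr R)) -/wR wc c0 scale0r.
have qR0 : ratr q != 0 :> R by rewrite fmorph_eq0.
pose k := c / ratr q.
have k0 : k != 0 by rewrite mulf_neq0 ?invr_eq0.
have kz i : (z i)%:~R = k * x i 0.
  apply: (mulfI qR0); rewrite mulrA mulrCA mulfV// mulr1.
  have := congr1 (fun y : 'cV__ => y i 0) wc.
  by rewrite !mxE => <-; rewrite wz rmorphM /= ratr_int.
have ak0 : 0 < `|k| by rewrite normr_gt0.
(* Since [k] may be negative, the positive factor [|k|] is used and [z] changes sign accordingly,
   which keeps it primitive. *)
exists `|k| => //; split; [|split; [|split]].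
- by rewrite -scalemxAr Ax scaler0.
- by move/eqP; rewrite scaler_eq0 gt_eqF//=; apply/negP/eqP.
- exists (fun i => if 0 < k then z i else - z i); split=> [i|e ez].
    rewrite mxE; case: ltrP => k_sg; first by rewrite kz gtr0_norm.
    by rewrite mulrNz kz ler0_norm ?mulNr.
  by apply: zprim => i; move: (ez i) => /=; case: ifP; rewrite ?rpredN.
- by rewrite -scalemxAr suppvZ ?gt_eqF.
Qed.

Lemma circuit_scale_eq n mA mB (A : 'M[R]_(mA, n)) (B : 'M[R]_(mB, n)) g g' (c : R) :
  circuit A B g -> circuit A B g' -> 0 < c -> g = c *: g' -> g = g'.
Proof.
move=> [_ [_ [[z [gz pz]] _]]] [_ [_ [[z' [gz' pz']] _]]] c0 gg'.
rewrite gg' (primitive_vec_scale_eq1 pz pz' c0) ?scale1r// => i.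
by rewrite -gz -gz' gg' mxE.
Qed.

End RationalKernel.

Theorem theorem4 (R : realType) (n mA mB : nat)
  (A0 : 'M[rat]_(mA, n)) (B0 : 'M[rat]_(mB, n))
  (b : 'cV[R]_mA) (d : 'cV[R]_mB) :
  let A : 'M[R]_(mA, n) := map_mx (@ratr R) A0 in
  let B : 'M[R]_(mB, n) := map_mx (@ratr R) B0 in
  \rank (col_mx A B) = n ->
  exists I : {set 'I_mB},
    let inT' (r : trip R n mB) := exists2 i, i \in I & r = T_elt R n i in
    (#|I| <= mB)%N /\
    (* T' \cup S is the set of extreme-ray generators of the cone *)
    (forall r, inS A B r \/ inT' r -> extreme_ray (ABcone A B) r) /\
    (forall r, extreme_ray (ABcone A B) r ->
       exists s, (inS A B s \/ inT' s) /\ exists2 c : R, 0 < c & r = tscale c s) /\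
    (forall s s' (c : R), inS A B s \/ inT' s -> inS A B s' \/ inT' s' ->
       0 < c -> s = tscale c s' -> s = s') /\
    (* vertices of P_{A,B} are S_1 \cup T'_1 *)
    (forall p, extreme_point (PAB A B) p <->
       exists r, (inS A B r \/ inT' r) /\ p = tscale (ynorm r)^-1 r).
Proof.
move=> A B rankAB.
have pointed (x : 'cV[R]_n) : A *m x = 0 -> B *m x = 0 -> x = 0.
  move=> Ax Bx; have full : row_full (col_mx A B) by apply/eqP.
  by apply: (row_full_inj full); rewrite mul_col_mx Ax Bx col_mx0 mulmx0.
(* The indices whose [T_elt] does not split; [asbool] turns this proposition into a boolean
   membership test. *)
exists [set i | `[< ~ exists x : 'cV[R]_n, A *m x = 0 /\ B *m x = delta_mx i 0 >]].
move=> inT'.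
have gen_ext r : inS A B r \/ inT' r -> extreme_ray (ABcone A B) r.
  move=> [[g [Ag [g0 [_ gmin]]] ->]|[i iI ->]]; first exact: S_elt_extreme.
  by apply: T_elt_extreme => //; move: iI; rewrite inE => /asboolP.
have ext_gen r : extreme_ray (ABcone A B) r ->
    exists s, (inS A B s \/ inT' s) /\ exists2 c : R, 0 < c & r = tscale c s.
  move=> /extreme_ray_S_or_T[[i [iI [c c0 rE]]]|[Ax x0 xmin rE]].
    exists (T_elt R n i); split; last by exists c; rewrite // tscaleE.
    by right; exists i; rewrite // inE; apply/asboolP.
  have [k k0 kcirc] := supp_minimal_circuit pointed Ax x0 xmin.
  exists (S_elt B (k *: r.1.1)); split; first by left; exists (k *: r.1.1).
  exists k^-1; first by rewrite invr_gt0.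
  by rewrite tscaleE S_eltZ ?(ltW k0)// -rE scalerK// gt_eqF.
split; first by rewrite -[leqRHS]card_ord max_card.
split; [exact: gen_ext|split; [exact: ext_gen|split]].
(* The mixed cases are impossible: a circuit is nonzero, while [T_elt] has zero [x] part. *)
- move=> s s' c [[g gc ->]|[i _ ->]] [[g' gc' ->]|[i' _ ->]] c0 [].
  + by move=> gg' _ _; rewrite (circuit_scale_eq gc gc' c0 gg').
  + by move=> g0; case: gc => _ [[]]; rewrite g0 scaler0.
  + move=> /esym/eqP; rewrite scaler_eq0 gt_eqF//= => /eqP g0.
    by case: gc' => _ [[]].
  + move=> _ _ /matrixP/(_ i 0); rewrite !mxE !eqxx andbT.
    by case: eqP => [->//|_] /eqP; rewrite mulr0 oner_eq0.
- move=> p; split=> [/(extreme_pointP pointed)[ext_p p1]|[r [rgen ->]]].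
    have [s [sgen [c c0 pE]]] := ext_gen _ ext_p; exists s; split=> //.
    have cs : c * ynorm s = 1 by rewrite -p1 pE tscaleE ynormZ// ltW.
    suff -> : (ynorm s)^-1 = c by [].
    rewrite -[LHS]mul1r -cs mulfK//; apply/eqP => s0; move/eqP: cs.
    by rewrite s0 mulr0 eq_sym oner_eq0.
  have ext_r := gen_ext _ rgen; have [Kr [r0 _]] := ext_r.
  have nr : 0 < ynorm r := ynorm_gt0 pointed Kr r0.
  apply/(extreme_pointP pointed); rewrite tscaleE; split.
    by apply: extreme_ray_scale; rewrite // invr_gt0.
  by rewrite ynormZ ?invr_ge0 ?ltW// mulVf// gt_eqF.
Qed.
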